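(* As formal power series in $x$ and $y$, $$\sum_{n=0}^\infty \sum_{k=-n}^n p_n(k)\, \frac{x^{n+k}}{(n+k)!}\,\frac{y^{n-k}}{(n-k)!} = \frac{\cosh\Bigl(\frac{1}{\sqrt2}(x-y)\Bigr)}{\cosh\Bigl(\frac{1}{\sqrt2}(x+y)\Bigr) -\frac{1}{\sqrt2}(x+y)\sinh\Bigl(\frac{1}{\sqrt2}(x+y)\Bigr)}.$$
   Context: A permutation $a_1a_2\cdots a_m$ of a finite totally ordered set (written as a word listing each element exactly once) is called an up-up-or-down-down permutation if, for every integer $i$ with $1\le i<m/2$, one has $a_{2i-1}<a_{2i}$ if and only if $a_{2i}<a_{2i+1}$. For integers $n\ge 0$ and $-n\le k\le n$, $p_n(k)$ denotes the number of up-up-or-down-down permutations $a_1a_2\cdots a_{2n+1}$ of the $(2n+1)$-element set $\{-n,-n+1,\dots,0,\dots,n-1,n\}$ with last entry $a_{2n+1}=k$. (In particular $p_0(0)=1$.) *)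

(* Defs.v *)
From HB Require Import structures.
From mathcomp Require Import all_boot all_order all_algebra.
From mathcomp Require Import boolp.

Set Implicit Arguments.
Unset Strict Implicit.
Unset Printing Implicit Defensive.

Import Order.TTheory GRing.Theory Num.Theory.
Local Open Scope ring_scope.

(** * Up-up-or-down-down permutations *)

(* Words are 0-indexed, so that [a`_(2 * i - 2)], [a`_(2 * i - 1)], [a`_(2 * i)]
   are the entries a_(2i-1), a_(2i), a_(2i+1) of the 1-indexed word. The bound
   [2 * i < size a] is i < m/2 over the rationals. *)
Definition up_up_or_down_down (a : seq int) : bool :=
  [forall i : 'I_(size a), (1 <= i)%N && (2 * i < size a)%N ==>
     ((a`_(2 * i - 2) < a`_(2 * i - 1)) == (a`_(2 * i - 1) < a`_(2 * i)))].

(* -n, -n+1, ..., n *)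
Definition symm_range (n : nat) : seq int :=
  [seq i%:Z - n%:Z | i <- iota 0 (2 * n).+1].

(* [permutations s] is a duplicate-free list of the rearrangements of [s]. *)
Definition num_uudd (n : nat) (k : int) : nat :=
  size [seq a <- permutations (symm_range n) |
         up_up_or_down_down a & last 0 a == k].

(** * Formal power series in two variables *)

(* [f i j] is the coefficient of x^i y^j. The record keeps the Cauchy product
   apart from pointwise structures on functions. *)
Record fps2 (R : fieldType) := FPS2 { coef2 :> nat -> nat -> R }.

HB.instance Definition _ (R : fieldType) := gen_eqMixin (fps2 R).
HB.instance Definition _ (R : fieldType) := gen_choiceMixin (fps2 R).

Section Ring.
Variable R : fieldType.
Implicit Types f g h : fps2 R.

Lemma fps2P f g : (forall i j, f i j = g i j) -> f = g.
Proof.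
case: f => f; case: g => g /= fg; congr FPS2.
by apply/funext => i; apply/funext => j.
Qed.

Definition fps2_const (c : R) := FPS2 (fun i j => c *+ ((i == 0%N) && (j == 0%N))).
Definition fps2_opp f := FPS2 (fun i j => - f i j).
Definition fps2_add f g := FPS2 (fun i j => f i j + g i j).
Definition fps2_mul f g := FPS2 (fun i j =>
  \sum_(a < i.+1) \sum_(b < j.+1) f a b * g (i - a)%N (j - b)%N).
Definition fps2_scale (c : R) f := FPS2 (fun i j => c * f i j).

Fact fps2_addA : associative fps2_add.
Proof. by move=> f g h; apply: fps2P => i j /=; rewrite addrA. Qed.
Fact fps2_addC : commutative fps2_add.
Proof. by move=> f g; apply: fps2P => i j /=; rewrite addrC. Qed.
Fact fps2_add0 : left_id (fps2_const 0) fps2_add.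
Proof. by move=> f; apply: fps2P => i j /=; rewrite mul0rn add0r. Qed.
Fact fps2_addN : left_inverse (fps2_const 0) fps2_opp fps2_add.
Proof. by move=> f; apply: fps2P => i j /=; rewrite mul0rn addNr. Qed.

HB.instance Definition _ :=
  GRing.isZmodule.Build (fps2 R) fps2_addA fps2_addC fps2_add0 fps2_addN.

(* [p] agrees with [f] up to degree i in x and j in y. *)
Let approx i j (p : {poly {poly R}}) f :=
  forall a b, (a <= i)%N -> (b <= j)%N -> p`_a`_b = f a b.

Let approx_ex i j f : exists p, approx i j p f.
Proof.
exists (\poly_(a < i.+1) \poly_(b < j.+1) f a b) => a b ai bj.
by rewrite coef_poly ltnS ai coef_poly ltnS bj.
Qed.

Let approx_mul i j p q f g :
  approx i j p f -> approx i j q g -> approx i j (p * q) (fps2_mul f g).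
Proof.
move=> pf qg a b ai bj; rewrite coefM coef_sum /=; apply: eq_bigr => c _.
rewrite coefM; apply: eq_bigr => d _.
have ca : (c <= i)%N by apply: leq_trans ai; rewrite -ltnS.
have db : (d <= j)%N by apply: leq_trans bj; rewrite -ltnS.
by rewrite pf // qg // (leq_trans (leq_subr _ _)).
Qed.

Let approx_add i j p q f g :
  approx i j p f -> approx i j q g -> approx i j (p + q) (fps2_add f g).
Proof. by move=> pf qg a b ai bj; rewrite !coefD pf ?qg. Qed.

Let approx1 i j : approx i j 1 (fps2_const 1).
Proof. by move=> [|a] [|b] _ _; rewrite coef1 ?coef1 ?coef0. Qed.

Fact fps2_mulA : associative fps2_mul.
Proof.
move=> f g h; apply: fps2P => i j.
have [p pf] := approx_ex i j f; have [q qg] := approx_ex i j g.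
have [r rh] := approx_ex i j h.
rewrite -(approx_mul pf (approx_mul qg rh)) // mulrA.
exact: (approx_mul (approx_mul pf qg) rh).
Qed.

Fact fps2_mulC : commutative fps2_mul.
Proof.
move=> f g; apply: fps2P => i j.
have [p pf] := approx_ex i j f; have [q qg] := approx_ex i j g.
by rewrite -(approx_mul pf qg) // mulrC; apply: (approx_mul qg pf).
Qed.

Fact fps2_mul1 : left_id (fps2_const 1) fps2_mul.
Proof.
move=> f; apply: fps2P => i j; have [p pf] := approx_ex i j f.
by rewrite -(approx_mul (@approx1 i j) pf) // mul1r pf.
Qed.

Fact fps2_mulDl : left_distributive fps2_mul fps2_add.
Proof.
move=> f g h; apply: fps2P => i j.
have [p pf] := approx_ex i j f; have [q qg] := approx_ex i j g.
have [r rh] := approx_ex i j h.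
rewrite -(approx_mul (approx_add pf qg) rh) // mulrDl.
exact: (approx_add (approx_mul pf rh) (approx_mul qg rh)).
Qed.

Fact fps2_one_neq0 : fps2_const 1 != 0.
Proof.
apply/eqP => /(congr1 (fun f : fps2 R => f 0%N 0%N)) /= /eqP.
by rewrite oner_eq0.
Qed.

HB.instance Definition _ := GRing.Zmodule_isComNzRing.Build (fps2 R)
  fps2_mulA fps2_mulC fps2_mul1 fps2_mulDl fps2_one_neq0.

Fact fps2_scaleA a b f :
  fps2_scale a (fps2_scale b f) = fps2_scale (a * b) f.
Proof. by apply: fps2P => i j /=; rewrite mulrA. Qed.
Fact fps2_scale1 : left_id 1 fps2_scale.
Proof. by move=> f; apply: fps2P => i j /=; rewrite mul1r. Qed.
Fact fps2_scaleDr : right_distributive fps2_scale +%R.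
Proof. by move=> c f g; apply: fps2P => i j /=; rewrite mulrDr. Qed.
Fact fps2_scaleDl f : {morph fps2_scale^~ f : a b / a + b}.
Proof. by move=> a b; apply: fps2P => i j /=; rewrite mulrDl. Qed.

HB.instance Definition _ := GRing.Zmodule_isLmodule.Build R (fps2 R)
  fps2_scaleA fps2_scale1 fps2_scaleDr fps2_scaleDl.

Fact fps2_scaleAl (c : R) f g : c *: (f * g) = (c *: f) * g.
Proof.
apply: fps2P => i j /=; rewrite mulr_sumr; apply: eq_bigr => a _.
by rewrite mulr_sumr; apply: eq_bigr => b _; rewrite mulrA.
Qed.

HB.instance Definition _ :=
  GRing.Lmodule_isLalgebra.Build R (fps2 R) fps2_scaleAl.
HB.instance Definition _ := GRing.Lalgebra_isComAlgebra.Build R (fps2 R).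

Lemma coef2D f g i j : (f + g) i j = f i j + g i j. Proof. by []. Qed.
Lemma coef2N f i j : (- f) i j = - f i j. Proof. by []. Qed.
Lemma coef2B f g i j : (f - g) i j = f i j - g i j. Proof. by []. Qed.
Lemma coef2Z c f i j : (c *: f) i j = c * f i j. Proof. by []. Qed.
Lemma coef20 i j : (0 : fps2 R) i j = 0. Proof. exact: mul0rn. Qed.
Lemma coef21 i j : (1 : fps2 R) i j = ((i == 0%N) && (j == 0%N))%:R.
Proof. by []. Qed.
Lemma coef2M f g i j : (f * g) i j =
  \sum_(a < i.+1) \sum_(b < j.+1) f a b * g (i - a)%N (j - b)%N.
Proof. by []. Qed.
Lemma coef2_sum I (r : seq I) P (F : I -> fps2 R) i j :
  (\sum_(k <- r | P k) F k) i j = \sum_(k <- r | P k) F k i j.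
Proof.
by elim/big_rec2: _ => [|k x y _ <-]; rewrite ?coef20 ?coef2D.
Qed.
Lemma coef2M00 f g : (f * g) 0%N 0%N = f 0%N 0%N * g 0%N 0%N.
Proof. by rewrite coef2M !big_ord1. Qed.

Lemma coef2_exp_eq0 f m i j :
  f 0%N 0%N = 0 -> (i + j < m)%N -> (f ^+ m) i j = 0.
Proof.
move=> f0; elim: m i j => // m IHm i j ijm.
rewrite exprS coef2M big1 // => -[a /= ai] _; rewrite big1 // => -[b /= bj] _.
have [/andP[/eqP-> /eqP->]|ab] := boolP ((a == 0%N) && (b == 0%N)).
  by rewrite f0 mul0r.
rewrite ltnS in ijm; rewrite !ltnS in ai bj.
rewrite IHm ?mulr0 //; apply: leq_trans ijm.
rewrite negb_and -!lt0n in ab; case/orP: ab => [a0|b0].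
  by rewrite -addSn; apply: leq_add _ (leq_subr _ _); rewrite ltn_subrL a0 (leq_trans a0).
by rewrite -addnS; apply: leq_add (leq_subr _ _) _; rewrite ltn_subrL b0 (leq_trans b0).
Qed.

(** Convergence of a series of formal power series: every coefficient of the
    partial sums is eventually constant. *)
Definition fps2_sums_to (F : nat -> fps2 R) f : Prop :=
  forall i j, exists N, forall M, (N <= M)%N -> (\sum_(m < M) F m) i j = f i j.

Lemma fps2_sums_to_unique F f g :
  fps2_sums_to F f -> fps2_sums_to F g -> f = g.
Proof.
move=> Ff Fg; apply: fps2P => i j.
have [N HN] := Ff i j; have [M HM] := Fg i j.
by rewrite -(HN (maxn N M)) ?leq_maxl // HM ?leq_maxr.
Qed.

(* The composite sum_m c_m f^m. It is meaningful only when [f] has no constant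
   term; then f^m has no term of total degree < m, so the truncation of the sum
   at m = i + j does not affect the coefficient. *)
Definition fps2_subst (c : nat -> R) f : fps2 R :=
  FPS2 (fun i j => \sum_(m < (i + j).+1) c m * (f ^+ m) i j).

Lemma fps2_substE (c : nat -> R) f i j M : f 0%N 0%N = 0 -> (i + j < M)%N ->
  (\sum_(m < M) c m *: f ^+ m) i j = fps2_subst c f i j.
Proof.
move=> f0 ijM; rewrite coef2_sum -(subnKC ijM) big_split_ord /=.
rewrite [X in _ + X]big1 ?addr0 // => m _.
by rewrite coef2_exp_eq0 ?mulr0 // leq_addr.
Qed.

Lemma fps2_substP (c : nat -> R) f : f 0%N 0%N = 0 ->
  fps2_sums_to (fun m => c m *: f ^+ m) (fps2_subst c f).
Proof.
by move=> f0 i j; exists (i + j).+1 => M ijM; rewrite fps2_substE.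
Qed.

(* Units are the series with nonzero constant term c; the inverse is then
   c^-1 times the geometric series in 1 - c^-1 f. *)
Definition fps2_unit : {pred fps2 R} := [pred f : fps2 R | f 0%N 0%N != 0].
Definition fps2_inv f : fps2 R :=
  if f 0%N 0%N == 0 then f else
  (f 0%N 0%N)^-1 *: fps2_subst (fun=> 1) (1 - (f 0%N 0%N)^-1 *: f).

Fact fps2_mulVr : {in fps2_unit, left_inverse 1 fps2_inv *%R}.
Proof.
move=> f; rewrite inE => f0; rewrite /fps2_inv (negPf f0).
set u := 1 - _.
have u0 : u 0%N 0%N = 0 by rewrite coef2B coef2Z mulVf // subrr.
have -> : f = f 0%N 0%N *: (1 - u) by rewrite subKr scalerA divff // scale1r.
rewrite -scalerAl -scalerAr scalerA coef2Z coef2B u0 subr0 mulr1 mulVf // scale1r.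
apply: fps2P => i j.
transitivity (((\sum_(m < (i + j).+1) 1 *: u ^+ m) * (1 - u)) i j).
  rewrite !coef2M; apply: eq_bigr => -[a /= ai] _; apply: eq_bigr => -[b /= bj] _.
  congr (_ * _); apply/esym/(fps2_substE (fun=> 1)) => //; rewrite ltnS in ai bj.
  by rewrite ltnS leq_add.
under eq_bigr do rewrite scale1r.
have -> : (\sum_(m < (i + j).+1) u ^+ m) * (1 - u) = 1 - u ^+ (i + j).+1.
  rewrite -[in RHS](expr1n _ (i + j).+1) subrXX mulrC; congr (_ * _).
  by apply: eq_bigr => m _; rewrite expr1n mul1r.
by rewrite coef2B [X in _ - X]coef2_exp_eq0 // subr0.
Qed.

Fact fps2_unitPl f g : g * f = 1 -> fps2_unit f.
Proof.
move=> /(congr1 (fun h : fps2 R => h 0%N 0%N)); rewrite coef2M00 coef21 /= => gf.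
by apply/eqP => f0; move/eqP: gf; rewrite f0 mulr0 eq_sym oner_eq0.
Qed.

Fact fps2_inv_out : {in [predC fps2_unit], fps2_inv =1 id}.
Proof. by move=> f; rewrite !inE negbK /fps2_inv => ->. Qed.

HB.instance Definition _ := GRing.ComNzRing_hasMulInverse.Build (fps2 R)
  fps2_mulVr fps2_unitPl fps2_inv_out.

Lemma fps2_unitE f : (f \is a GRing.unit) = (f 0%N 0%N != 0).
Proof. by []. Qed.

Definition fps2_X : fps2 R := FPS2 (fun i j => ((i == 1%N) && (j == 0%N))%:R).
Definition fps2_Y : fps2 R := FPS2 (fun i j => ((i == 0%N) && (j == 1%N))%:R).

(* As for [fps2_subst], these are meant for [f] without constant term. *)
Definition fps2_cosh f := fps2_subst (fun m => (~~ odd m)%:R / m`!%:R) f.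
Definition fps2_sinh f := fps2_subst (fun m => (odd m)%:R / m`!%:R) f.

End Ring.

Arguments fps2_X {R}.
Arguments fps2_Y {R}.

(* Main.v *)
Require Import Defs.
From mathcomp Require Import all_boot all_order all_algebra.
From mathcomp Require Import zify ring.
From HB Require Import structures.

Set Implicit Arguments.
Unset Strict Implicit.
Unset Printing Implicit Defensive.

Import Order.TTheory GRing.Theory Num.Theory.
Local Open Scope ring_scope.

(** The last three letters a, b, k of an up-up-or-down-down word are monotone.
    Deleting b and k leaves a shorter such word ending in a, and everything
    depends on the letters only through their relative order. If P n j is the
    number of words of length 2n+1 whose last letter has rank j, then the number
    of admissible b, given that a has rank t after the deletion, is |t+1-j|
    ([size_uudd_with_lastE]), so that

      P (n+1) j = sum over t <= 2n of |t + 1 - j| P n t.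

    Since t |-> |t| has second difference 2 at 0 and 0 elsewhere, the second
    difference of P (n+1) in j is 2 P n ([uudd_count_diff2]). For the exponential
    generating function F, in which x^i y^j / (i! j!) has coefficient
    P ((i+j)/2) i, this says delta (delta F) = 2 F with delta = d/dx - d/dy.
    Moreover F is symmetric ([uudd_count_sym]), and evaluating the recurrence at
    its two largest ranks gives F(x,0) = 1 + (x/2) (delta F)(x,0)
    ([uudd_count_last]).

    These three properties determine a series ([uudd_problem_unique]): in each
    total degree the difference of two solutions has egf coefficients that form
    an arithmetic progression, constant by symmetry, and zero by the boundary
    condition.

    The quotient C/D of the theorem has them too ([closed_form_problem]). The
    derivation delta kills x + y, hence D, and multiplies cosh and sinh of
    c (x - y) by 2c while exchanging them, where (2c)^2 = 2. Symmetry holds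
    because cosh is even. At y = 0 both x + y and x - y become x, and the
    boundary condition is the definition of D. *)

(** * Words with a prescribed last letter *)

Definition uudd_with_last (s : seq int) (k : int) : seq (seq int) :=
  [seq a <- permutations s | up_up_or_down_down a & last 0 a == k].

Lemma up_up_or_down_downP (a : seq int) :
  reflect (forall i, (0 < i)%N -> (2 * i < size a)%N ->
      (a`_(2 * i - 2) < a`_(2 * i - 1)) = (a`_(2 * i - 1) < a`_(2 * i)))
    (up_up_or_down_down a).
Proof.
apply: (iffP forallP) => [H i i0 ia | H [i /= _]]; last first.
  by apply/implyP => /andP[i0 ia]; apply/eqP/H.
have hi : (i < size a)%N by lia.
by have /implyP/(_ _)/eqP := H (Ordinal hi); apply; rewrite i0.
Qed.

(** Only the last index i of the condition sees the two new letters, because the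
    old word has odd length. *)
Lemma up_up_or_down_down_rcons2 (a : seq int) (b k : int) : odd (size a) ->
  up_up_or_down_down (rcons (rcons a b) k) =
  up_up_or_down_down a && ((last 0 a < b) == (b < k)).
Proof.
move=> odd_a; have a0 : (0 < size a)%N by case: (size a) odd_a.
have nth_a i : (i < size a)%N -> (rcons (rcons a b) k)`_i = a`_i.
  by move=> ia; rewrite !nth_rcons size_rcons ia ltnS ltnW.
have nth_b : (rcons (rcons a b) k)`_(size a) = b.
  by rewrite !nth_rcons size_rcons ltnSn ltnn eqxx.
have nth_k : (rcons (rcons a b) k)`_(size a).+1 = k.
  by rewrite nth_rcons size_rcons ltnn eqxx.
have last_a : (rcons (rcons a b) k)`_(size a).-1 = last 0 a.
  by rewrite nth_a ?nth_last // prednK.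
have sz : size (rcons (rcons a b) k) = (size a).+2 by rewrite !size_rcons.
apply/up_up_or_down_downP/andP => [H | [/up_up_or_down_downP Ha /eqP Hb] i i0].
  split.
    apply/up_up_or_down_downP => i i0 ia.
    by rewrite -!nth_a; first (apply: H; rewrite ?sz); lia.
  have := H (size a).+1./2; rewrite sz.
  have -> : (2 * (size a).+1./2 - 2 = (size a).-1)%N by lia.
  have -> : (2 * (size a).+1./2 - 1 = size a)%N by lia.
  have -> : (2 * (size a).+1./2 = (size a).+1)%N by lia.
  by rewrite nth_b nth_k last_a => ->; lia.
rewrite sz => i2; have [ia|ia] := ltnP (2 * i) (size a).
  by rewrite !nth_a; first (by apply: Ha); lia.
have -> : (2 * i - 2 = (size a).-1)%N by lia.
have -> : (2 * i - 1 = size a)%N by lia.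
have -> : (2 * i = (size a).+1)%N by lia.
by rewrite nth_b nth_k last_a Hb.
Qed.

Definition strictly_between (c b k : int) : bool :=
  (c < b < k) || (k < b < c).

Lemma strictly_between_neq (c b k : int) : strictly_between c b k ->
  [/\ b != k, c != b & c != k].
Proof. by rewrite /strictly_between; split; lia. Qed.

Lemma perm_rem2 (a s : seq int) (b k : int) : b != k -> k \in s -> b \in s ->
  perm_eq (rcons (rcons a b) k) s = perm_eq a (rem b (rem k s)).
Proof.
move=> bk ks bs.
have brem : b \in rem k s by apply: rem_mem.
rewrite (permPl (_ : perm_eq _ [:: k, b & a])); last first.
  by rewrite perm_rcons perm_cons perm_rcons.
by rewrite (permPr (perm_to_rem ks)) perm_cons (permPr (perm_to_rem brem)) perm_cons.
Qed.

(** A word is determined by its antepenultimate letter c, its penultimate letter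
    b and the word that remains when b and k are deleted. The condition on the
    triple c, b, k is that b lies strictly between the other two. *)
Lemma size_uudd_with_last (s : seq int) (k : int) :
    uniq s -> odd (size s) -> (1 < size s)%N -> k \in s ->
  size (uudd_with_last s k) =
  (\sum_(c <- s) \sum_(b <- s | strictly_between c b k)
     size (uudd_with_last (rem b (rem k s)) c))%N.
Proof.
move=> us os s1 ks.
pose ends : seq (int * int) :=
  [seq (c, b) | c <- s, b <- [seq b <- s | strictly_between c b k]].
pose ext (cb : int * int) (a : seq int) := rcons (rcons a cb.2) k.
pose words := [seq ext cb a | cb <- ends,
                 a <- uudd_with_last (rem cb.2 (rem k s)) cb.1].
have mem_ends c b : ((c, b) \in ends) =
    [&& c \in s, b \in s & strictly_between c b k].
  apply/allpairsPdep/and3P => [[c' [b' [cs]]]|[cs bs sb]].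
    by rewrite mem_filter => /andP[sb bs] [-> ->].
  by exists c, b; rewrite mem_filter sb.
have uends : uniq ends.
  apply: allpairs_uniq_dep => // [c _|]; first exact: filter_uniq.
  by move=> [c b] [c' b'] _ _ /= [-> ->].
suff /perm_size -> : perm_eq (uudd_with_last s k) words.
  rewrite size_allpairs_dep sumnE big_map /ends.
  rewrite big_allpairs_dep /=; apply: eq_bigr => c _.
  by rewrite big_filter.
(* Both lists are duplicate-free, so only the membership has to be compared. *)
apply: uniq_perm.
- by rewrite filter_uniq // permutations_uniq.
- apply: allpairs_uniq_dep => // [cb _|].
    by rewrite filter_uniq // permutations_uniq.
  move=> /= p p' /allpairsPdep[[c b] [a [_ ha ->]]].
  move=> /allpairsPdep[[c' b'] [a' [_ ha' ->]]] /=.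
  rewrite /ext /= => E; have [E2] := rcons_inj E; have [ea eb] := rcons_inj E2.
  move: ha ha'; rewrite !mem_filter /= => /andP[/andP[_ /eqP hc] _].
  move=> /andP[/andP[_ /eqP hc'] _]; subst a' b'.
  by have -> : c = c' by rewrite -hc.
move=> w; apply/idP/allpairsPdep => [|[[c b] [a []]]].
  rewrite mem_filter mem_permutations => /andP[/andP[hw /eqP lw] pw].
  have := perm_size pw; case/lastP: w hw lw pw => [|w k'] hw lw pw /=.
    by move=> s0; move: s1; rewrite -s0.
  move: lw; rewrite last_rcons => kE; subst k'.
  case/lastP: w hw pw => [|a b] hw pw /=; first by move=> s0; move: s1; rewrite -s0.
  rewrite !size_rcons => sz.
  have odda : odd (size a) by move: os; rewrite -sz /= negbK.
  move: hw; rewrite up_up_or_down_down_rcons2 // => /andP[ha /eqP hb].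
  have uw : uniq (rcons (rcons a b) k) by rewrite (perm_uniq pw).
  have bs : b \in s by rewrite -(perm_mem pw) !(mem_rcons, inE) eqxx orbT.
  have la : last 0 a \in a by case: (a) odda => //= z t _; rewrite mem_last.
  have cs : last 0 a \in s by rewrite -(perm_mem pw) !(mem_rcons, inE) la !orbT.
  move: uw; rewrite !rcons_uniq mem_rcons inE negb_or.
  move=> /andP[/andP[kb ka] /andP[ba ua]].
  exists (last 0 a, b), a; split => //; last first.
    by rewrite mem_filter /= ha eqxx mem_permutations -perm_rem2 // eq_sym.
  rewrite mem_ends cs bs /= /strictly_between hb.
  have lb : last 0 a != b by apply: contraNneq ba => <-.
  by move: hb; case: (ltgtP b k) kb; case: (ltgtP (last 0 a) b) lb.
rewrite mem_ends => /and3P[cs bs sb].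
rewrite !mem_filter !mem_permutations /= => /andP[/andP[ha /eqP la] pa] ->.
have [bk _ _] := strictly_between_neq sb.
have pw : perm_eq (rcons (rcons a b) k) s by rewrite perm_rem2.
have oa : odd (size a) 
  by move: os; rewrite -(perm_size pw) !size_rcons /= negbK.
rewrite /ext pw /= last_rcons eqxx up_up_or_down_down_rcons2 // ha la !andbT /=.
by move: sb; rewrite /strictly_between; case: (ltgtP b k); case: (ltgtP c b).
Qed.
(** * Counting by the rank of the last letter *)

Definition rank (s : seq int) (x : int) : nat := count (< x) s.

(** The sum of the two truncated differences is the distance |i + 1 - j|. *)
Fixpoint uudd_count (n j : nat) : nat :=
  if n is m.+1
  then (\sum_(i < (2 * m).+1) ((i.+1 - j) + (j - i.+1)) * uudd_count m i)%N
  else 1%N.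

Lemma count_between (s : seq int) (x y : int) : uniq s -> x \in s -> x < y ->
  (count (fun z => x < z < y) s + rank s x).+1 = rank s y.
Proof.
move=> us xs xy; rewrite -addn1.
have {xs}<- : count_mem x s = 1%N by rewrite count_uniq_mem ?xs.
elim: {us} s => //= z s <-; move: xy.
by case: (ltgtP z x) => [zx|xz|->]; case: (ltgtP z y) => //=; lia.
Qed.

Lemma rank_lt (s : seq int) (x y : int) : uniq s -> x \in s -> x < y ->
  (rank s x < rank s y)%N.
Proof. by move=> us xs xy; rewrite -(@count_between s x y) // ltnS leq_addl. Qed.

Lemma perm_map_rank (s : seq int) : uniq s ->
  perm_eq (map (rank s) s) (iota 0 (size s)).
Proof.
move=> us.
have inj : {in s &, injective (rank s)}.
  move=> x y xs ys xy; apply/eqP; case: (ltgtP x y) => // lt.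
    by have := rank_lt us xs lt; rewrite xy ltnn.
  by have := rank_lt us ys lt; rewrite xy ltnn.
have um : uniq (map (rank s) s) by rewrite map_inj_in_uniq.
have sub : {subset map (rank s) s <= iota 0 (size s)}.
  move=> _ /mapP[x xs ->]; rewrite mem_iota add0n /=.
  rewrite -(count_predC (< x) s) /rank -[X in (X < _)%N]addn0 ltn_add2l -has_count.
  by apply/hasP; exists x => //=; rewrite ltxx.
apply: uniq_perm => //; first exact: iota_uniq.
by have [] := uniq_min_size um sub _; rewrite ?size_iota ?size_map.
Qed.

(** The ranks of the elements of a set of size m are 0, ..., m - 1. *)
Lemma sum_over_rank (s : seq int) (G : nat -> nat) : uniq s ->
  (\sum_(x <- s) G (rank s x) = \sum_(i < size s) G i)%N.
Proof.
move=> us; rewrite -(big_map (rank s) xpredT G).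
by rewrite -(big_mkord xpredT G) /index_iota subn0; apply/perm_big/perm_map_rank.
Qed.

Lemma count_strictly_between (s : seq int) (c k : int) :
    uniq s -> c \in s -> k \in s ->
  count (fun b => strictly_between c b k) s =
  ((rank s k - (rank s c).+1) + (rank s c - (rank s k).+1))%N.
Proof.
move=> us cs ks; have [ck|kc|<-] := ltgtP c k.
- rewrite -(@count_between s c k) // (@eq_count _ _ (fun z => c < z < k)); first lia.
  by move=> b; rewrite /= /strictly_between; case: (ltgtP k b); rewrite ?andbF ?orbF //; lia.
- rewrite -(@count_between s k c) // (@eq_count _ _ (fun z => k < z < c)); first lia.
  by move=> b; rewrite /= /strictly_between; lia.
rewrite (@eq_count _ _ pred0) ?count_pred0; first lia.
by move=> b; rewrite /= /strictly_between; lia.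
Qed.

(** The deleted letters b and k lie on the same side of c. *)
Lemma rank_rem2 (s : seq int) (c b k : int) :
    b \in s -> k \in s -> strictly_between c b k ->
  rank (rem b (rem k s)) c = if c < k then rank s c else (rank s c - 2)%N.
Proof.
move=> bs ks /orP[|] /andP[h1 h2]; rewrite /rank !count_rem ks /=.
  have kc : (k < c) = false by lia.
  have bc : (b < c) = false by lia.
  by rewrite kc bc andbF !subn0 (lt_trans h1 h2).
have bk : b \in rem k s by apply: rem_mem => //; lia.
by rewrite bk h2 (lt_trans h1 h2) /= ifF -?subnDA // ltNge ltW // (lt_trans h1 h2).
Qed.

(** On the left, i is the rank of the letter c before the deletion of b and k; on
    the right it is the rank afterwards, which is smaller by 2 when c lies above
    the last letter. *)
Lemma uudd_count_rec (m j : nat) : (j <= (2 * m).+2)%N ->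
  (\sum_(i < (2 * m).+3) ((j - i.+1) + (i - j.+1)) *
     uudd_count m (if i < j then nat_of_ord i else i - 2))%N = uudd_count m.+1 j.
Proof.
move=> jm; rewrite [RHS]/=.
rewrite (eq_bigr (fun i : 'I_(2 * m).+3 =>
    (j - i.+1) * uudd_count m i + (i - j.+1) * uudd_count m (i - 2))%N); last first.
  move=> i _; have [ij|ij] := ltnP i j.
    have -> : (i - j.+1 = 0)%N by lia.
    by rewrite mul0n !addn0.
  have -> : (j - i.+1 = 0)%N by lia.
  by rewrite mul0n !add0n.
rewrite [RHS](eq_bigr (fun i : 'I_(2 * m).+1 =>
    (j - i.+1) * uudd_count m i + (i.+1 - j) * uudd_count m i)%N); last first.
  by move=> i _; rewrite addnC mulnDl.
rewrite !big_split; congr (_ + _)%N.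
  rewrite [LHS]big_ord_recr /= (@big_ord_recr _ _ addn (2 * m).+1) /=.
  have -> : (j - (2 * m).+2 = 0)%N by lia.
  have -> : (j - (2 * m).+3 = 0)%N by lia.
  by rewrite !mul0n !addn0.
rewrite [LHS]big_ord_recl /= (@big_ord_recl _ _ addn (2 * m).+1) /= sub0n subSS sub0n !mul0n.
by apply: eq_bigr => i _; rewrite subSS subSS subn1.
Qed.

(** Working with arbitrary finite sets of integers makes renumbering of the
    letters unnecessary: deleting b and k leaves another such set, to which the
    induction hypothesis applies. *)
Theorem size_uudd_with_lastE (n : nat) (s : seq int) (k : int) :
    uniq s -> size s = (2 * n).+1 -> k \in s ->
  size (uudd_with_last s k) = uudd_count n (rank s k).
Proof.
elim: n s k => [|n IHn] s k us sz ks.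
  case: s us sz ks => [|x [|]] //= _ _; rewrite inE => /eqP->.
  rewrite /uudd_with_last /= eqxx andbT.
  case: ifP => // /up_up_or_down_downP[] i i0 /=; lia.
have odd_s : odd (size s) by rewrite sz; lia.
rewrite size_uudd_with_last //; last by rewrite sz; lia.
pose G i := (((rank s k - i.+1) + (i - (rank s k).+1)) *
   uudd_count n (if i < rank s k then i else i - 2))%N.
transitivity (\sum_(c <- s) G (rank s c))%N.
  apply: eq_big_seq => c cs; rewrite /G -count_strictly_between //.
  rewrite -sum1_count big_distrl /= big_seq_cond [RHS]big_seq_cond.
  apply: eq_bigr => b /andP[bs sb]; rewrite mul1n.
  have [bk cb ck] := strictly_between_neq sb.
  have brem : b \in rem k s by apply: rem_mem.
  have crem : c \in rem b (rem k s) by do 2![apply: rem_mem => //].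
  rewrite IHn ?rem_uniq //; last by rewrite !size_rem // sz; lia.
  rewrite rank_rem2 //; congr (uudd_count n _).
  have [lck|kc] := ltP c k; first by rewrite rank_lt.
  rewrite ifF //; apply/negbTE; rewrite -leqNgt.
  move: kc; rewrite le_eqVlt => /orP[/eqP-> //|kc].
  exact/ltnW/rank_lt.
rewrite sum_over_rank // /G sz mulnS !addSn uudd_count_rec //.
rewrite -ltnS -[X in (_ < X)%N](_ : size s = _) ?sz; last by lia.
have := perm_mem (perm_map_rank us) (rank s k).
by rewrite map_f // mem_iota sz => /esym/andP[_]; lia.
Qed.

(** * Linear relations between the counts *)

(** As a function of j, the distance |i + 1 - j| has second difference 2 at
    j = i + 1 and 0 elsewhere. *)
Lemma uudd_count_diff2 (n j : nat) : (j <= 2 * n)%N ->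
  (uudd_count n.+1 j.+2 + uudd_count n.+1 j =
   2 * uudd_count n.+1 j.+1 + 2 * uudd_count n j)%N.
Proof.
move=> jn; have hj : (j < (2 * n).+1)%N by [].
have -> : uudd_count n j =
    (\sum_(i < (2 * n).+1) (i == j :> nat) * uudd_count n i)%N.
  rewrite (bigD1 (Ordinal hj)) //= eqxx mul1n big1 ?addn0 // => i.
  by rewrite -val_eqE => /= /negPf->.
rewrite /= !big_distrr -!big_split /=; apply: eq_bigr => i _.
rewrite -mulnDl !mulnA -mulnDl; congr (_ * _)%N.
move: (nat_of_ord i) => t; lia.
Qed.

Lemma uudd_count_sym (n j : nat) : (j <= 2 * n)%N ->
  uudd_count n (2 * n - j) = uudd_count n j.
Proof.
elim: n j => // n IHn j jn /=.
rewrite (reindex_inj rev_ord_inj) /=; apply: eq_bigr => -[i i_lt] _ /=.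
by rewrite subSS IHn //; congr (_ * _)%N; lia.
Qed.

(** Write T for the sum of the P n i and a, b for the values of P (n+1) at ranks
    2n+2 and 2n+1. The weights give a - b = T, and the weights at the two extreme
    ranks add up to the constant 2n+2; by symmetry 2 a = (2n+2) T. Eliminating T
    leaves a = (n+1) (a - b), stated without subtraction. *)
Lemma uudd_count_last (n : nat) :
  (uudd_count n.+1 (2 * n).+2 + n.+1 * uudd_count n.+1 (2 * n).+1 =
   n.+1 * uudd_count n.+1 (2 * n).+2)%N.
Proof.
set T := (\sum_(i < (2 * n).+1) uudd_count n i)%N.
have slope : uudd_count n.+1 (2 * n).+2 = (uudd_count n.+1 (2 * n).+1 + T)%N.
  rewrite /= /T -big_split /=; apply: eq_bigr => -[i i_lt] _ /=.
  by rewrite -mulSnr; congr (_ * _)%N; lia.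
have ends : (uudd_count n.+1 (2 * n).+2 + uudd_count n.+1 0 = (2 * n).+2 * T)%N.
  rewrite /= /T big_distrr -big_split /=; apply: eq_bigr => -[i i_lt] _ /=.
  by rewrite -mulnDl; congr (_ * _)%N; lia.
have sym : uudd_count n.+1 (2 * n).+2 = uudd_count n.+1 0.
  by rewrite -(@uudd_count_sym n.+1 0) // subn0 mulnS.
have half : uudd_count n.+1 (2 * n).+2 = (n.+1 * T)%N by nia.
by rewrite [in RHS]slope mulnDr -half addnC.
Qed.

(** * Substitutions and derivations of power series *)

Section FormalPowerSeries.
Variable R : fieldType.
Implicit Types f g : fps2 R.

Definition fps2_swap f : fps2 R := FPS2 (fun i j => f j i).

Fact fps2_swap_is_linear : linear fps2_swap.
Proof. by move=> c f g; apply: fps2P. Qed.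
HB.instance Definition _ :=
  GRing.isLinear.Build R (fps2 R) (fps2 R) _ fps2_swap fps2_swap_is_linear.

Fact fps2_swap_is_monoid_morphism : monoid_morphism fps2_swap.
Proof.
split=> [|f g]; apply: fps2P => i j; first by rewrite /= andbC.
by rewrite /= exchange_big.
Qed.
HB.instance Definition _ := GRing.isMonoidMorphism.Build (fps2 R) (fps2 R)
  fps2_swap fps2_swap_is_monoid_morphism.

(** Substitution of 0 for y. *)
Definition fps2_y0 f : fps2 R := FPS2 (fun i j => f i 0%N *+ (j == 0%N)).

Fact fps2_y0_is_linear : linear fps2_y0.
Proof.
by move=> c f g; apply: fps2P => i j /=; rewrite mulrnDl mulrnAr.
Qed.
HB.instance Definition _ :=
  GRing.isLinear.Build R (fps2 R) (fps2 R) _ fps2_y0 fps2_y0_is_linear.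

Fact fps2_y0_is_monoid_morphism : monoid_morphism fps2_y0.
Proof.
split=> [|f g]; apply: fps2P => i j.
  by rewrite /= andbT; case: (j == 0%N); rewrite ?andbT // andbF.
rewrite /= -sumrMnl; apply: eq_bigr => a _.
rewrite big_ord1 subnn big_ord_recl /= mulrnAr subn0 big1 ?addr0 // => b _.
by rewrite mulr0n mul0r.
Qed.
HB.instance Definition _ := GRing.isMonoidMorphism.Build (fps2 R) (fps2 R)
  fps2_y0 fps2_y0_is_monoid_morphism.

(** The hypothesis on phi says that it does not lower total degrees. It allows
    the composite to be replaced by a finite sum, through which an algebra
    morphism passes. *)
Lemma fps2_map_subst (phi : {lrmorphism fps2 R -> fps2 R}) (c : nat -> R) f :
    (forall (g h : fps2 R) i j, (forall a b, (a + b <= i + j)%N -> g a b = h a b) ->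
       phi g i j = phi h i j) ->
    f 0%N 0%N = 0 -> phi (fps2_subst c f) = fps2_subst c (phi f).
Proof.
move=> phi_local f0; apply: fps2P => i j.
rewrite (phi_local _ (\sum_(m < (i + j).+1) c m *: f ^+ m)).
  rewrite linear_sum coef2_sum; apply: eq_bigr => m _.
  by rewrite linearZ /= rmorphXn.
by move=> a b ab; rewrite fps2_substE.
Qed.

Lemma fps2_swap_subst c f : f 0%N 0%N = 0 ->
  fps2_swap (fps2_subst c f) = fps2_subst c (fps2_swap f).
Proof.
by apply: (@fps2_map_subst fps2_swap) => g h i j gh /=; apply: gh; rewrite addnC.
Qed.

Lemma fps2_y0_subst c f : f 0%N 0%N = 0 ->
  fps2_y0 (fps2_subst c f) = fps2_subst c (fps2_y0 f).
Proof.
apply: (@fps2_map_subst fps2_y0) => g h i j gh /=.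
by case: eqP => // j0; rewrite gh // j0.
Qed.

Lemma fps2_subst_even (c : nat -> R) f : (forall m, odd m -> c m = 0) ->
  fps2_subst c (- f) = fps2_subst c f.
Proof.
move=> c_odd; apply: fps2P => i j; apply: eq_bigr => m _.
have [om|em] := boolP (odd m); first by rewrite c_odd // !mul0r.
by rewrite exprNn -signr_odd (negPf em) expr0 mul1r.
Qed.

Definition fps2_dx f : fps2 R := FPS2 (fun i j => i.+1%:R * f i.+1 j).

(** In the term of f g indexed by a, the factor i + 1 splits as
    a + (i + 1 - a): the first part differentiates f, the second g. *)
Lemma fps2_dxM f g : fps2_dx (f * g) = fps2_dx f * g + f * fps2_dx g.
Proof.
apply: fps2P => i j; rewrite coef2D /=.
transitivity (\sum_(a < i.+2) \sum_(b < j.+1)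
    (a%:R * f a b * g (i.+1 - a)%N (j - b)%N +
     f a b * ((i.+1 - a)%:R * g (i.+1 - a)%N (j - b)%N))).
  rewrite mulr_sumr; apply: eq_bigr => a _; rewrite mulr_sumr.
  apply: eq_bigr => b _; rewrite mulrCA -mulrA [a%:R * _]mulrCA -mulrDr -mulrDl.
  by rewrite -natrD subnKC // -ltnS.
rewrite [LHS](eq_bigr _ (fun a _ => big_split _ _ _ _ _)) big_split /=; congr (_ + _).
  rewrite big_ord_recl /= big1 ?add0r => [|b _]; last by rewrite !mul0r.
  by apply: eq_bigr => a _; apply: eq_bigr => b _; rewrite /bump /= add1n subSS.
rewrite big_ord_recr /= [X in _ + X]big1 ?addr0 => [|b _]; last first.
  by rewrite subnn mul0r mulr0.
by apply: eq_bigr => -[a /= ai] _; apply: eq_bigr => b _; rewrite subSn.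
Qed.

(** The derivation d/dx - d/dy. *)
Definition fps2_delta f : fps2 R :=
  FPS2 (fun i j => i.+1%:R * f i.+1 j - j.+1%:R * f i j.+1).

Lemma coef2_delta f i j :
  fps2_delta f i j = i.+1%:R * f i.+1 j - j.+1%:R * f i j.+1.
Proof. by []. Qed.

Lemma fps2_deltaE f :
  fps2_delta f = fps2_dx f - fps2_swap (fps2_dx (fps2_swap f)).
Proof. by []. Qed.

Fact fps2_delta_is_linear : linear fps2_delta.
Proof.
move=> c f g; apply: fps2P => i j.
rewrite [RHS]coef2D coef2Z !coef2_delta /=.
by rewrite !mulrDr !mulrN ![c * (_ * _)]mulrCA opprD addrACA.
Qed.
HB.instance Definition _ :=
  GRing.isLinear.Build R (fps2 R) (fps2 R) _ fps2_delta fps2_delta_is_linear.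

Lemma fps2_deltaZ c f : fps2_delta (c *: f) = c *: fps2_delta f.
Proof. exact: linearZ. Qed.

Lemma fps2_deltaB f g : fps2_delta (f - g) = fps2_delta f - fps2_delta g.
Proof. exact: linearB. Qed.

Lemma fps2_delta_sum I (r : seq I) (P : pred I) (F : I -> fps2 R) :
  fps2_delta (\sum_(i <- r | P i) F i) = \sum_(i <- r | P i) fps2_delta (F i).
Proof. exact: linear_sum. Qed.

Lemma fps2_deltaM f g : fps2_delta (f * g) = fps2_delta f * g + f * fps2_delta g.
Proof.
rewrite !fps2_deltaE fps2_dxM rmorphM fps2_dxM rmorphD !rmorphM /=.
have swapK h : fps2_swap (fps2_swap h) = h by apply: fps2P.
by rewrite !swapK opprD addrACA mulrBl mulrBr.
Qed.

Lemma fps2_delta1 : fps2_delta 1 = 0.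
Proof. by apply: fps2P => i j; rewrite coef20 coef2_delta !coef21 /= andbF !mulr0 subrr. Qed.

Lemma fps2_deltaX f (e : R) m : fps2_delta f = e%:A ->
  fps2_delta (f ^+ m) = (m%:R * e) *: f ^+ m.-1.
Proof.
move=> fe; elim: m => [|m IHm]; first by rewrite expr0 fps2_delta1 mul0r scale0r.
rewrite exprS fps2_deltaM fe IHm mulr_algl -scalerAr -natr1 mulrDl mul1r scalerDl.
by rewrite addrC; case: m {IHm} => [|m]; rewrite ?mul0r ?scale0r // -exprS.
Qed.

(** The chain rule for an inner series whose image under the derivation is a
    constant, the only case that occurs here. *)
Lemma fps2_delta_subst (c : nat -> R) f (e : R) :
    f 0%N 0%N = 0 -> fps2_delta f = e%:A ->
  fps2_delta (fps2_subst c f) = e *: fps2_subst (fun m => m.+1%:R * c m.+1) f.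
Proof.
move=> f0 fe; apply: fps2P => i j.
transitivity (fps2_delta (\sum_(m < (i + j).+2) c m *: f ^+ m) i j).
  by rewrite !coef2_delta !fps2_substE //; rewrite ?addSn ?addnS.
rewrite fps2_delta_sum big_ord_recl expr0 fps2_deltaZ fps2_delta1 scaler0 add0r.
rewrite coef2_sum coef2Z mulr_sumr; apply: eq_bigr => m _.
rewrite fps2_deltaZ lift0 (fps2_deltaX _ fe) !coef2Z -pred_Sn.
by rewrite !mulrA [c _ * _]mulrC [_ * e]mulrC !mulrA.
Qed.

Lemma fps2_delta_unitV f :
  f \is a GRing.unit -> fps2_delta f = 0 -> fps2_delta f^-1 = 0.
Proof.
move=> uf df; apply: (mulrI uf); rewrite mulr0 -fps2_delta1 -(divrr uf).
by rewrite fps2_deltaM df mul0r add0r.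
Qed.

Lemma coef2_mulX f i j :
  (fps2_X * f) i j = if i is i'.+1 then f i' j else 0.
Proof.
rewrite coef2M; case: i => [|i].
  by rewrite big_ord1 big1 // => b _; rewrite /= mul0r.
rewrite big_ord_recl big1 ?add0r => [|b _]; last by rewrite /= mul0r.
rewrite big_ord_recl [X in _ + X]big1 ?addr0 => [|a _]; last first.
  by rewrite big1 // => b _; rewrite /= mul0r.
rewrite big_ord_recl big1 ?addr0 => [|b _]; last by rewrite /= mul0r.
by rewrite /= mul1r subn0 subSS subn0.
Qed.

End FormalPowerSeries.

Lemma coef2_subst00 (R : fieldType) (c : nat -> R) (f : fps2 R) :
  fps2_subst c f 0%N 0%N = c 0%N.
Proof. by rewrite /= big_ord1 expr0 mulr1. Qed.

Lemma eq_fps2_subst (R : fieldType) (c d : nat -> R) (f : fps2 R) :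
  c =1 d -> fps2_subst c f = fps2_subst d f.
Proof. by move=> cd; apply: fps2P => i j; apply: eq_bigr => m _; rewrite cd. Qed.

(** * A boundary value problem with a unique solution *)

Section BoundaryValueProblem.
Variable R : numFieldType.
Implicit Types f g : fps2 R.

Lemma divf_factS (b m : nat) :
  m.+1%:R * (b%:R / (m.+1)`!%:R) = b%:R / m`!%:R :> R.
Proof.
by rewrite factS natrM mulrCA invfM mulVKf // pnatr_eq0.
Qed.

Lemma fps2_delta_cosh f (e : R) : f 0%N 0%N = 0 -> fps2_delta f = e%:A ->
  fps2_delta (fps2_cosh f) = e *: fps2_sinh f.
Proof.
move=> f0 fe; rewrite /fps2_cosh (fps2_delta_subst _ f0 fe); congr (_ *: _).
by apply: eq_fps2_subst => m; rewrite divf_factS /= negbK.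
Qed.

Lemma fps2_delta_sinh f (e : R) : f 0%N 0%N = 0 -> fps2_delta f = e%:A ->
  fps2_delta (fps2_sinh f) = e *: fps2_cosh f.
Proof.
move=> f0 fe; rewrite /fps2_sinh (fps2_delta_subst _ f0 fe); congr (_ *: _).
by apply: eq_fps2_subst => m; rewrite divf_factS.
Qed.

(** The last equation says f(x,0) = 1 + (x/2) (delta f)(x,0). *)
Definition uudd_problem f : Prop :=
  [/\ fps2_delta (fps2_delta f) = 2 *: f, fps2_swap f = f &
      fps2_y0 f = 1 + 2^-1 *: (fps2_X * fps2_y0 (fps2_delta f))].

(** By induction on the total degree N. The numbers q m = m! (N-m)! f m (N-m)
    have vanishing second differences by the induction hypothesis in degree N-2,
    so they form an arithmetic progression. Symmetry makes it constant, and the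
    boundary equation q N = (N/2) (q N - q (N-1)) makes it zero. *)
Lemma homogeneous_problem_eq0 f :
    fps2_delta (fps2_delta f) = 2 *: f -> fps2_swap f = f ->
    fps2_y0 f = 2^-1 *: (fps2_X * fps2_y0 (fps2_delta f)) ->
  f = 0.
Proof.
move=> f_de f_sym f_y0.
have sym i j : f i j = f j i by rewrite -[in LHS]f_sym.
have bdry i : f i 0%N = 2^-1 * (if i is i'.+1 then fps2_delta f i' 0%N else 0).
  have := congr1 (fun h : fps2 R => h i 0%N) f_y0.
  rewrite coef2Z coef2_mulX => E; rewrite -[f i 0%N]/(fps2_y0 f i 0%N) E.
  by case: i {E}.
have de i j : i.+1%:R * (i.+2%:R * f i.+2 j - j.+1%:R * f i.+1 j.+1) -
    j.+1%:R * (i.+1%:R * f i.+1 j.+1 - j.+2%:R * f i j.+2) = 2 * f i j.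
  by have := congr1 (fun h : fps2 R => h i j) f_de; rewrite !coef2_delta coef2Z.
suff lvl N : forall m, (m <= N)%N -> f m (N - m)%N = 0.
  by apply: fps2P => i j; rewrite coef20 -(lvl (i + j)%N i) ?leq_addr // addKn.
elim/ltn_ind: N => -[_ [|//] _|N IHN].
  by rewrite bdry mulr0.
pose q m := m`!%:R * (N.+1 - m)`!%:R * f m (N.+1 - m)%N.
have q_diff2 m : (m.+2 <= N.+1)%N -> q m.+2 - 2 * q m.+1 + q m = 0.
  move=> mN; rewrite /q.
  have [j jE] : exists j, (N.+1 = m + j.+2)%N by exists (N.+1 - m.+2)%N; lia.
  have -> : (N.+1 - m.+2 = j)%N by lia.
  have -> : (N.+1 - m.+1 = j.+1)%N by lia.
  have -> : (N.+1 - m = j.+2)%N by lia.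
  have fmj : f m j = 0.
    have hN : (m + j < N.+1)%N by lia.
    by have := IHN _ hN m (leq_addr _ _); rewrite addKn.
  have := de m j; rewrite fmj mulr0 => dE.
  (* The equation for f at (m, j), multiplied by m! j!. *)
  transitivity (m`!%:R * j`!%:R * (0 : R)); last by rewrite mulr0.
  by rewrite -dE !factS !natrM; ring.
have q_affine m : (m <= N)%N -> q m = q 0%N + m%:R * (q 1%N - q 0%N) /\
    q m.+1 = q 0%N + m.+1%:R * (q 1%N - q 0%N).
  elim: m => [_|m IHm mN]; first by split; ring.
  have [E1 E2] := IHm (ltnW mN); split=> //.
  have /eqP := q_diff2 m mN; rewrite addrAC subr_eq0 => /eqP qE.
  have -> : q m.+2 = 2 * q m.+1 - q m by rewrite -qE addrK.
  by rewrite E1 E2 -[m.+2]addn2 -[m.+1]addn1 !natrD; ring.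
have q_sym : q N.+1 = q 0%N.
  by rewrite /q subnn subn0 sym [X in X * _ = _]mulrC.
have slope0 : q 1%N - q 0%N = 0.
  have [_ qN] := q_affine N (leqnn N).
  move: qN; rewrite q_sym => /eqP; rewrite eq_sym addrC -subr_eq0 addrK.
  by rewrite mulf_eq0 pnatr_eq0 /= => /eqP.
have q_const m : (m <= N.+1)%N -> q m = q 0%N.
  case: m => [//|m] mN; have [_ ->] := q_affine m mN.
  by rewrite slope0 mulr0 addr0.
have q_last : q N.+1 = 2^-1 * N.+1%:R * (q N.+1 - q N).
  rewrite /q subnn subSnn [1`!]/= fact0 !mulr1 [in LHS]bdry coef2_delta.
  by rewrite factS natrM; ring.
have q0 : q 0%N = 0.
  by rewrite -q_sym q_last !q_const // subrr mulr0.
move=> m mN; have /eqP := q_const m mN.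
by rewrite q0 /q !mulf_eq0 !pnatr_eq0 !gtn_eqF ?fact_gt0 //= => /eqP.
Qed.

Lemma uudd_problem_unique f g : uudd_problem f -> uudd_problem g -> f = g.
Proof.
move=> [f1 f2 f3] [g1 g2 g3]; apply/eqP; rewrite -subr_eq0; apply/eqP.
apply: homogeneous_problem_eq0.
- by rewrite !fps2_deltaB f1 g1 scalerBr.
- by rewrite rmorphB /= f2 g2.
rewrite fps2_deltaB !rmorphB /= f3 g3 mulrBr scalerBr opprD addrACA subrr.
by rewrite add0r.
Qed.

End BoundaryValueProblem.

(** * The generating function solves the problem *)

Section Solutions.
Variable R : numFieldType.

(** Words have odd length, so an odd number i + j of letters other than the last
    does not occur. *)
Definition uudd_series : fps2 R := FPS2 (fun i j =>
  if odd (i + j) then 0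
  else (uudd_count (i + j)./2 i)%:R / (i`!%:R * j`!%:R)).

Lemma uudd_series_even n i j : (i + j = 2 * n)%N ->
  uudd_series i j = (uudd_count n i)%:R / (i`!%:R * j`!%:R).
Proof. by move=> ijn; rewrite /= ijn mul2n odd_double doubleK. Qed.

Lemma uudd_series_odd i j : odd (i + j) -> uudd_series i j = 0.
Proof. by rewrite /= => ->. Qed.

Lemma factr_neq0 n : n`!%:R != 0 :> R.
Proof. by rewrite pnatr_eq0 -lt0n fact_gt0. Qed.

Lemma uudd_series_problem : uudd_problem uudd_series.
Proof.
split; apply: fps2P => i j.
- rewrite coef2Z !coef2_delta.
  have [oij|eij] := boolP (odd (i + j)).
    by rewrite !uudd_series_odd ?mulr0 ?subrr ?mulr0 ?subrr //; lia.
  have ijn : (i + j = 2 * (i + j)./2)%N by lia.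
  set n := (i + j)./2 in ijn.
  rewrite (@uudd_series_even n i j) // (@uudd_series_even n.+1 i.+2 j); last lia.
  rewrite (@uudd_series_even n.+1 i.+1 j.+1); last lia.
  rewrite (@uudd_series_even n.+1 i j.+2); last lia.
  have jn : (i <= 2 * n)%N by lia.
  have E := congr1 (fun m => m%:R : R) (uudd_count_diff2 jn).
  rewrite natrD [in RHS]natrD 2!natrM in E.
  have -> : (uudd_count n i)%:R =
    ((uudd_count n.+1 i.+2)%:R + (uudd_count n.+1 i)%:R
     - 2%:R * (uudd_count n.+1 i.+1)%:R) / 2 :> R by rewrite E; field.
  rewrite !factS !natrM; field.
  by rewrite !factr_neq0 !nat1r -!natrD !pnatr_eq0.
- change (uudd_series j i = uudd_series i j).
  have [oij|eij] := boolP (odd (i + j)).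
    by rewrite !uudd_series_odd // addnC.
  have ijn : (i + j = 2 * (i + j)./2)%N by lia.
  set n := (i + j)./2 in ijn.
  rewrite (@uudd_series_even n j i) 1?addnC // (@uudd_series_even n i j) //.
  have -> : j = (2 * n - i)%N by lia.
  by rewrite uudd_count_sym 1?[X in _ / X]mulrC //; lia.
rewrite coef2D coef21 coef2Z coef2_mulX.
have -> : fps2_y0 uudd_series i j = uudd_series i 0%N *+ (j == 0%N) by [].
case: j => [|j]; last first.
  by rewrite andbF mulr0n add0r; case: i => [|i]; rewrite ?[fps2_y0 _ _ _]mulr0n mulr0.
case: i => [|i].
  by rewrite (@uudd_series_even 0) // fact0 mulr1 divr1 mulr0 addr0.
rewrite mulr1n add0r.
have -> : fps2_y0 (fps2_delta uudd_series) i 0%N = fps2_delta uudd_series i 0%N by [].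
rewrite coef2_delta.
have [ei|oi] := boolP (odd i.+1).
  by rewrite !uudd_series_odd ?addn0 ?addn1 // !mulr0 subrr mulr0.
have iE : i = (2 * i./2).+1 by move: oi => /=; lia.
set n := i./2 in iE; rewrite {}iE.
rewrite (@uudd_series_even n.+1 _ 0%N); last lia.
rewrite (@uudd_series_even n.+1 _ 1%N); last lia.
have E := congr1 (fun m => m%:R : R) (uudd_count_last n).
rewrite natrD !natrM in E.
rewrite [in LHS](_ : (uudd_count n.+1 (2 * n).+2)%:R =
    n.+1%:R * ((uudd_count n.+1 (2 * n).+2)%:R - (uudd_count n.+1 (2 * n).+1)%:R)); last first.
  by rewrite mulrBr -E addrK.
rewrite fact0 (_ : 1`! = 1%N) // (factS (2 * n).+1) natrM.
have -> : (2 * n).+2%:R = 2 * n.+1%:R :> R by rewrite -natrM mulnS.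
field.
by rewrite factr_neq0 nat1r pnatr_eq0.
Qed.

End Solutions.
(** * The closed form solves the problem *)

Section ClosedForm.
Variables (R : numFieldType) (c : R).
Hypothesis c2 : 2 * c ^+ 2 = 1.

Let x : fps2 R := fps2_X.
Let y : fps2 R := fps2_Y.
Let C := fps2_cosh (c *: (x - y)).
Let S := fps2_sinh (c *: (x - y)).
Let D := fps2_cosh (c *: (x + y)) - c *: (x + y) * fps2_sinh (c *: (x + y)).

Let sub00 : (c *: (x - y)) 0%N 0%N = 0.
Proof. by rewrite coef2Z coef2B /= subrr mulr0. Qed.

Let add00 : (c *: (x + y)) 0%N 0%N = 0.
Proof. by rewrite coef2Z coef2D /= addr0 mulr0. Qed.

Let delta_x : fps2_delta x = 1.
Proof.
apply: fps2P => i j; rewrite coef2_delta coef21 /= andbF mulr0 subr0.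
by case: i => [|i] /=; rewrite ?mul1r ?mulr0.
Qed.

Let delta_y : fps2_delta y = - 1.
Proof.
apply: fps2P => i j; rewrite coef2_delta coef2N coef21 /= mulr0 sub0r.
by case: j => [|j] /=; rewrite ?andbT ?andbF ?mul1r ?mulr0.
Qed.

Let delta_sub : fps2_delta (c *: (x - y)) = (2 * c)%:A.
Proof.
by rewrite fps2_deltaZ fps2_deltaB delta_x delta_y opprK mulrC -scalerA scaler_nat.
Qed.

Let delta_add : fps2_delta (c *: (x + y)) = 0%:A.
Proof.
rewrite -[y]opprK fps2_deltaZ fps2_deltaB -[- y]scaleN1r fps2_deltaZ.
by rewrite delta_x delta_y scaleN1r opprK subrr scaler0 scale0r.
Qed.

(* Only x - y varies along the derivation; D is a function of x + y. *)
Let deltaD : fps2_delta D = 0.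
Proof.
rewrite /D fps2_deltaB fps2_deltaM (fps2_delta_cosh add00 delta_add).
by rewrite (fps2_delta_sinh add00 delta_add) delta_add !scale0r mul0r mulr0 addr0 subr0.
Qed.

Let D_unit : D \is a GRing.unit.
Proof.
rewrite fps2_unitE /D coef2B coef2M00 add00 mul0r subr0 coef2_subst00.
by rewrite /= fact0 divr1 oner_eq0.
Qed.

Lemma delta_closed_form : fps2_delta (C / D) = (2 * c) *: (S / D).
Proof.
rewrite fps2_deltaM (fps2_delta_unitV D_unit deltaD) mulr0 addr0.
by rewrite (fps2_delta_cosh sub00 delta_sub) -scalerAl.
Qed.

Let swap_C : fps2_swap C = C.
Proof.
rewrite /C fps2_swap_subst // -[RHS]fps2_subst_even; last first.
  by move=> m om; rewrite om mul0r.
rewrite -scalerN opprB; congr fps2_subst.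
by apply: fps2P => i j; rewrite /= ![(j == _) && _]andbC.
Qed.

Let swap_D : fps2_swap D = D.
Proof.
have swap_add : fps2_swap (c *: (x + y)) = c *: (x + y).
  by apply: fps2P => i j; rewrite /= ![(j == _) && _]andbC addrC.
have swap_subst d : fps2_swap (fps2_subst d (c *: (x + y))) =
    fps2_subst d (c *: (x + y)) by rewrite fps2_swap_subst // swap_add.
rewrite /D rmorphB rmorphM /= [fps2_swap (_ *: _)]swap_add.
rewrite [fps2_swap (fps2_cosh _)]swap_subst.
by rewrite [fps2_swap (fps2_sinh _)]swap_subst.
Qed.

Let y0_sub : fps2_y0 (c *: (x - y)) = c *: x.
Proof.
by apply: fps2P => i [|j] /=; rewrite ?andbF ?andbT ?subr0 ?mulr0.
Qed.

Let y0_add : fps2_y0 (c *: (x + y)) = c *: x.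
Proof.
by apply: fps2P => i [|j] /=; rewrite ?andbF ?andbT ?addr0 ?mulr0.
Qed.

Lemma closed_form_problem : uudd_problem (C / D).
Proof.
split.
- rewrite delta_closed_form fps2_deltaZ fps2_deltaM.
  rewrite (fps2_delta_unitV D_unit deltaD) mulr0 addr0.
  rewrite (fps2_delta_sinh sub00 delta_sub) -scalerAl scalerA.
  have -> : 2 * c * (2 * c) = 2 * (2 * c ^+ 2) by ring.
  by rewrite c2 mulr1.
- rewrite rmorphM /= swap_C; congr (_ * _).
  apply: (mulrI D_unit); rewrite divrr // -{1}swap_D -rmorphM /= divrr //.
  exact: rmorph1.
rewrite delta_closed_form linearZ /= !rmorphM /=.
set V := fps2_y0 D^-1.
have y0_add_subst d : fps2_y0 (fps2_subst d (c *: (x + y))) =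
    fps2_subst d (c *: x) by rewrite fps2_y0_subst // y0_add.
have y0_sub_subst d : fps2_y0 (fps2_subst d (c *: (x - y))) =
    fps2_subst d (c *: x) by rewrite fps2_y0_subst // y0_sub.
have y0D : fps2_y0 D = fps2_cosh (c *: x) - c *: x * fps2_sinh (c *: x).
  rewrite /D rmorphB rmorphM /= [fps2_y0 (_ *: _)]y0_add.
  by rewrite [fps2_y0 (fps2_cosh _)]y0_add_subst [fps2_y0 (fps2_sinh _)]y0_add_subst.
have DV : fps2_y0 D * V = 1.
  by rewrite /V -rmorphM divrr // [LHS]rmorph1.
rewrite [fps2_y0 C]y0_sub_subst [fps2_y0 S]y0_sub_subst.
rewrite -[1 in RHS]DV y0D mulrBl -scalerAr scalerA mulKf ?pnatr_eq0 //.
by rewrite mulrA -!scalerAl subrK.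
Qed.

End ClosedForm.

(** * The series of the theorem *)

Section SummingTheSeries.
Variable R : numFieldType.

Definition fps2_monomial (a b : nat) : fps2 R :=
  FPS2 (fun i j => ((i == a) && (j == b))%:R).

Lemma fps2_monomialM a b a' b' :
  fps2_monomial a b * fps2_monomial a' b' = fps2_monomial (a + a') (b + b').
Proof.
apply: fps2P => i j; rewrite coef2M /=.
have [/andP[/eqP-> /eqP->]|ij] := boolP (_ && _).
  have ha : (a < (a + a').+1)%N by rewrite ltnS leq_addr.
  have hb : (b < (b + b').+1)%N by rewrite ltnS leq_addr.
  rewrite (bigD1 (Ordinal ha)) //= (bigD1 (Ordinal hb)) //= !addKn !eqxx mul1r.
  rewrite big1 => [|q]; last by rewrite -val_eqE /= => /negPf->; rewrite mul0r.
  rewrite big1 ?addr0 // => p; rewrite -val_eqE /= => /negPf-> /=.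
  by rewrite big1 // => q _; rewrite mul0r.
rewrite big1 // => p _; rewrite big1 // => q _; rewrite -natrM mulnb.
rewrite [X in nat_of_bool X]negbTE //; apply: contra ij => /andP[/andP[/eqP pa /eqP qb] /andP[/eqP pa' /eqP qb']].
by have := ltn_ord p; have := ltn_ord q; lia.
Qed.

Lemma fps2_X_exp m : fps2_X ^+ m = fps2_monomial m 0.
Proof.
elim: m => [|m IHm]; first by apply: fps2P => i j.
by rewrite exprS IHm (fps2_monomialM 1 0).
Qed.

Lemma fps2_Y_exp m : fps2_Y ^+ m = fps2_monomial 0 m.
Proof.
elim: m => [|m IHm]; first by apply: fps2P => i j.
by rewrite exprS IHm (fps2_monomialM 0 1).
Qed.

Lemma fps2_div_nat (f : fps2 R) (m : nat) :
  (m != 0)%N -> f / m%:R = m%:R^-1 *: f.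
Proof.
move=> m0; have mR : m%:R != 0 :> R by rewrite pnatr_eq0.
have um : (m%:R : fps2 R) \is a GRing.unit.
  by rewrite fps2_unitE -scaler_nat coef2Z coef21 /= mulr1.
apply: (mulIr um).
by rewrite divrK // mulr_natr -scaler_nat scalerA mulfV // scale1r.
Qed.

Lemma symm_range_uniq n : uniq (symm_range n).
Proof.
by rewrite map_inj_uniq ?iota_uniq // => i j /addIr [].
Qed.

Lemma num_uuddE n i : (i <= 2 * n)%N -> num_uudd n (i%:Z - n%:Z) = uudd_count n i.
Proof.
move=> i_le; have hi : i%:Z - n%:Z \in symm_range n.
  by apply/mapP; exists i => //; rewrite mem_iota.
rewrite -[num_uudd _ _]/(size (uudd_with_last _ _)).
rewrite (@size_uudd_with_lastE n) ?symm_range_uniq ?size_map ?size_iota //.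
congr uudd_count; rewrite /rank count_map.
rewrite (@eq_count _ _ (fun j => (j < i)%N)); last by move=> j /=; lia.
have -> : (2 * n).+1 = (i + (2 * n - i).+1)%N by lia.
rewrite iotaD count_cat add0n [X in (X + _)%N](_ : _ = i); last first.
  rewrite -[RHS](size_iota 0 i); apply/eqP; rewrite -all_count.
  by apply/allP => j; rewrite mem_iota.
rewrite [X in (_ + X)%N](_ : _ = 0%N) ?addn0 //; apply/eqP.
rewrite -leqn0 leqNgt -has_count; apply/hasPn => j; rewrite mem_iota.
by rewrite -leqNgt => /andP[].
Qed.

(** The n-th term of the series is the homogeneous part of degree 2n of the
    generating function; hence each coefficient receives at most one term. *)
Lemma uudd_termE n :
  \sum_(k <- symm_range n)
    (num_uudd n k)%:R
      * (fps2_X ^+ absz (n%:Z + k) / (absz (n%:Z + k))`!%:R)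
      * (fps2_Y ^+ absz (n%:Z - k) / (absz (n%:Z - k))`!%:R) =
  FPS2 (fun i j => if (i + j == 2 * n)%N then uudd_series R i j else 0).
Proof.
have below i : absz (n%:Z + (i%:Z - n%:Z))%R = i by lia.
have above i : (i <= 2 * n)%N -> absz (n%:Z - (i%:Z - n%:Z))%R = (2 * n - i)%N.
  by lia.
pose a i : R := (uudd_count n i)%:R / (i`!%:R * (2 * n - i)`!%:R).
transitivity (\sum_(i < (2 * n).+1) a i *: fps2_monomial i (2 * n - i)).
  rewrite -(big_mkord xpredT (fun i => a i *: fps2_monomial i (2 * n - i))).
  rewrite /index_iota subn0 big_map; apply: eq_big_seq => i.
  rewrite mem_iota add0n /= => ilt.
  rewrite num_uuddE //.
  rewrite below above //.
  rewrite !fps2_div_nat ?gtn_eqF ?fact_gt0 // fps2_X_exp fps2_Y_exp.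
  rewrite -scaler_nat mulr_algl -scalerAr -!scalerAl fps2_monomialM addn0 add0n.
  by rewrite !scalerA /a invfM; congr (_ *: _); ring.
apply: fps2P => i j; rewrite coef2_sum.
have [ijn|ijn] := eqVneq (i + j)%N (2 * n)%N; last first.
  rewrite /= (negPf ijn) big1 // => -[p plt] _ /=.
  have [ip|] := eqVneq i p; last by rewrite mulr0.
  have [jp|] := eqVneq j (2 * n - p)%N; last by rewrite mulr0.
  by move: ijn; rewrite ip jp subnKC ?eqxx.
have ilt : (i < (2 * n).+1)%N by lia.
rewrite [RHS]/= ijn eqxx (bigD1 (Ordinal ilt)) //= big1 ?addr0.
  rewrite /a; have -> : j = (2 * n - i)%N by lia.
  by rewrite !eqxx mulr1 mul2n odd_double doubleK.
by move=> p; rewrite -val_eqE /= eq_sym => /negPf->; rewrite mulr0.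
Qed.

End SummingTheSeries.

Theorem mainTheorem1 (R : rcfType) :
  let x : fps2 R := fps2_X in
  let y : fps2 R := fps2_Y in
  let c : R := 1 / Num.sqrt 2 in
  fps2_sums_to
    (fun n : nat => \sum_(k <- symm_range n)
       (num_uudd n k)%:R
         * (x ^+ absz (n%:Z + k) / (absz (n%:Z + k))`!%:R)
         * (y ^+ absz (n%:Z - k) / (absz (n%:Z - k))`!%:R))
    (fps2_cosh (c *: (x - y))
     / (fps2_cosh (c *: (x + y)) - c *: (x + y) * fps2_sinh (c *: (x + y)))).
Proof.
move=> x y c.
have c2 : 2 * c ^+ 2 = 1.
  by rewrite /c div1r exprVn sqr_sqrtr ?ler0n // mulfV // pnatr_eq0.
rewrite (uudd_problem_unique (closed_form_problem c2) (uudd_series_problem R)).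
move=> i j; exists (i + j)./2.+1 => M ijM; rewrite coef2_sum.
under eq_bigr do rewrite uudd_termE.
have [oij|eij] := boolP (odd (i + j)).
  rewrite uudd_series_odd // big1 // => n _ /=; case: eqP => // ijn.
  by move: oij; rewrite ijn mul2n odd_double.
rewrite (bigD1 (Ordinal ijM)) //= ifT; last lia.
rewrite big1 ?addr0 // => n; rewrite -val_eqE /= => nij.
by rewrite ifF //; lia.
Qed.
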